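(* Fix integers $h\ge 2$ and $k\ge h+1$, and put $w=k-h-1$. There exists an integer $n_{\mathrm{int}}(k,k+h)\ge 2(k+h)+2$ such that for every $n\ge n_{\mathrm{int}}(k,k+h)$ the following holds. The partition $\{c\},\ L,\ I,\ W,\ \{y_1\},\ Y_2,\ Y_3$ of $V(G^\star_{h,k,n})$, after deleting the empty class $W$ when $w=0$, is equitable. Its class sizes are $(1,\,h,\,h+1,\,w,\,1,\,h-1,\,q_\star)$ with $q_\star=n-k-2h-1$, and its quotient matrix is $Q^\star_{h,k,n}$. Consequently, $$\rho\bigl(G^\star_{h,k,n}\bigr)=\rho\bigl(Q^\star_{h,k,n}\bigr).$$
   Context: All graphs are finite, simple and undirected; $\rho$ denotes the (adjacency) spectral radius. A partition $V_1,\dots,V_m$ of $V(G)$ into nonempty classes is equitable if every vertex of $V_i$ has the same number $q_{ij}$ of neighbors in $V_j$ for all $i,j$; its quotient matrix is $(q_{ij})$. Graph $G^\star_{h,k,n}$ ($h\ge2$): the vertex set is $X\,\dot\cup\,W\,\dot\cup\,Y$ with $|X|=2h+2$, $|W|=k-h-1$, $|Y|=n-k-h-1$, and $X=\{c\}\,\dot\cup\,L\,\dot\cup\,I$ with $|L|=h$, $|I|=h+1$. The graph induced on $X$ is the complete graph $K_X$ with the $h$ edges joining $c$ to the vertices of $L$ deleted; $W\cup Y$ induces a clique; every vertex of $W$ is adjacent to every vertex of $X$; the neighborhood of $c$ in $Y$ is $\{y_1,\dots,y_h\}$ for distinct $y_1,\dots,y_h\in Y$; the only neighbor in $Y$ of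 each vertex of $L$ is $y_1$; the vertices of $I$ have no neighbors in $Y$. Write $Y=\{y_1\}\,\dot\cup\,Y_2\,\dot\cup\,Y_3$ with $Y_2=\{y_2,\dots,y_h\}$, so $|Y_2|=h-1$ and $|Y_3|=q_\star$. With rows and columns ordered as $\{c\},L,I,W,\{y_1\},Y_2,Y_3$, $$Q^\star_{h,k,n}=\begin{pmatrix}0&0&h+1&w&1&h-1&0\\0&h-1&h+1&w&1&0&0\\1&h&h&w&0&0&0\\1&h&h+1&w-1&1&h-1&q_\star\\1&h&0&w&0&h-1&q_\star\\1&0&0&w&1&h-2&q_\star\\0&0&0&w&1&h-1&q_\star-1\end{pmatrix},$$ where, when $w=0$, the fourth row and fourth column are deleted. *)

(* Defs.v *)
From HB Require Import structures.
From mathcomp Require Import all_boot all_order all_algebra.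
Set Implicit Arguments.
Unset Strict Implicit.
Unset Printing Implicit Defensive.
Import Order.TTheory GRing.Theory Num.Theory.
Local Open Scope ring_scope.

Section SpectralRadius.
Variable C : numClosedFieldType.

Definition eigenvalues n (A : 'M[C]_n) : seq C :=
  sval (closed_field_poly_normal (char_poly A)).

(* C is only partially ordered, but the moduli compared here all lie in its
   totally ordered real part. *)
Definition spectral_radius n (A : 'M[C]_n) : C :=
  \big[Num.max/0]_(a <- eigenvalues A) `|a|.

Lemma mem_eigenvalues n (A : 'M[C]_n) a : (a \in eigenvalues A) = eigenvalue A a.
Proof.
rewrite /eigenvalues; case: closed_field_poly_normal => r /= def_p.
rewrite eigenvalue_root_char def_p (monicP (char_poly_monic A)) scale1r.
by rewrite root_prod_XsubC.
Qed.

Lemma spectral_radiusP n (A : 'M[C]_n) : (0 < n)%N ->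
  (exists2 a, eigenvalue A a & spectral_radius A = `|a|) /\
  (forall a, eigenvalue A a -> `|a| <= spectral_radius A).
Proof.
move=> n_gt0; rewrite /spectral_radius.
have nz : eigenvalues A != [::].
  rewrite /eigenvalues; case: closed_field_poly_normal => r /= def_p.
  apply/eqP=> r0; have := size_char_poly A.
  rewrite def_p r0 big_nil (monicP (char_poly_monic A)) scale1r size_poly1.
  by case: n n_gt0 {A def_p}.
suff [[a ra ->] le_a] : (exists2 a, a \in eigenvalues A &
     \big[Num.max/0]_(a <- eigenvalues A) `|a| = `|a|) /\
   (forall a, a \in eigenvalues A ->
     `|a| <= \big[Num.max/0]_(a <- eigenvalues A) `|a|).
  by split=> [|b]; [exists a; rewrite -?mem_eigenvalues | rewrite -mem_eigenvalues => /le_a].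
elim: (eigenvalues A) nz => // a [_ _|b s IH _].
  rewrite big_cons big_nil max_l //.
  split=> [|x]; first by exists a; rewrite ?mem_head.
  by rewrite inE => /eqP->.
have [//|[c cs def_m] le_m] := IH.
rewrite big_cons def_m; have cmp : (`|a| >=< `|c|)%O.
  by rewrite real_comparable ?normr_real.
split=> [|x].
  rewrite /Num.max /Order.max; case: ifP => _; last by exists a; rewrite ?mem_head.
  by exists c; rewrite // inE cs orbT.
rewrite inE comparable_le_max // => /predU1P[->|/le_m]; first by rewrite lexx.
by rewrite def_m => ->; rewrite orbT.
Qed.

End SpectralRadius.

Record sgraph := SGraph {
  svertex :> finType;
  sedge : rel svertex;
  sedge_sym : symmetric sedge;
  sedge_irrefl : irreflexive sedge
}.

Definition neighbors (G : sgraph) (v : G) : {set G} := [set u | sedge v u].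

Definition adjacency_mx (R : pzRingType) (G : sgraph) : 'M[R]_#|G| :=
  \matrix_(i, j) (sedge (enum_val i : G) (enum_val j))%:R.

Definition graph_spectral_radius (C : numClosedFieldType) (G : sgraph) : C :=
  spectral_radius (adjacency_mx C G).

Section Equitable.
Variables (G : sgraph) (m : nat).

Definition is_quotient_mx (P : 'I_m -> {set G}) (Q : 'M[int]_m) : Prop :=
  forall (i j : 'I_m) (v : G), v \in P i -> #|neighbors v :&: P j|%:Z = Q i j.

(* Injectivity makes distinct indices give distinct, hence disjoint, classes;
   [partition] also requires every class to be nonempty. *)
Definition equitable (P : 'I_m -> {set G}) : Prop :=
  [/\ injective P, partition [set P i | i : 'I_m] [set: G]
    & exists Q : 'M[int]_m, is_quotient_mx P Q].

End Equitable.

(* The set X is made of the vertices Xc, XL _ and XI _. *)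
Inductive gstar_vertex (h k n : nat) : Type :=
  | Xc
  | XL of 'I_h
  | XI of 'I_h.+1
  | VW of 'I_(k - h - 1)
  | VY of 'I_(n - k - h - 1).
Arguments Xc {h k n}.
Arguments XL {h k n}.
Arguments XI {h k n}.
Arguments VW {h k n}.
Arguments VY {h k n}.

Section GStar.
Variables h k n : nat.
Local Notation vertex := (gstar_vertex h k n).

Definition gstar_encode (v : vertex) :
    unit + ('I_h + ('I_h.+1 + ('I_(k - h - 1) + 'I_(n - k - h - 1)))) :=
  match v with
  | Xc => inl tt
  | XL i => inr (inl i)
  | XI i => inr (inr (inl i))
  | VW i => inr (inr (inr (inl i)))
  | VY i => inr (inr (inr (inr i)))
  end.

Definition gstar_decode
    (s : unit + ('I_h + ('I_h.+1 + ('I_(k - h - 1) + 'I_(n - k - h - 1))))) :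
    vertex :=
  match s with
  | inl _ => Xc
  | inr (inl i) => XL i
  | inr (inr (inl i)) => XI i
  | inr (inr (inr (inl i))) => VW i
  | inr (inr (inr (inr i))) => VY i
  end.

Lemma gstar_encodeK : cancel gstar_encode gstar_decode.
Proof. by case. Qed.

HB.instance Definition _ := Finite.copy vertex (can_type gstar_encodeK).

(* The vertices y_1, ..., y_h are VY 0, ..., VY (h - 1). *)
Definition gstar_edge : rel vertex := fun u v =>
  match u, v with
  | Xc, XL _ | XL _, Xc => false
  | Xc, VY j | VY j, Xc => (j < h)%N
  | XL _, VY j | VY j, XL _ => val j == 0%N
  | XI _, VY _ | VY _, XI _ => false
  | _, _ => u != v
  end.

Lemma gstar_edge_sym : symmetric gstar_edge.
Proof. by move=> [|i|i|i|i] [|j|j|j|j] //=; rewrite eq_sym. Qed.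

Lemma gstar_edge_irrefl : irreflexive gstar_edge.
Proof. by move=> [|i|i|i|i] /=; rewrite ?eqxx. Qed.

Definition gstar : sgraph := SGraph gstar_edge_sym gstar_edge_irrefl.

Definition gstar_C : {set gstar} := [set Xc].
Definition gstar_L : {set gstar} := [set XL i | i : 'I_h].
Definition gstar_I : {set gstar} := [set XI i | i : 'I_h.+1].
Definition gstar_W : {set gstar} := [set VW i | i : 'I_(k - h - 1)].
Definition gstar_Y1 : {set gstar} :=
  [set VY j | j : 'I_(n - k - h - 1) & val j == 0%N].
Definition gstar_Y2 : {set gstar} :=
  [set VY j | j : 'I_(n - k - h - 1) & (0 < j < h)%N].
Definition gstar_Y3 : {set gstar} :=
  [set VY j | j : 'I_(n - k - h - 1) & (h <= j)%N].

Definition gstar_w : nat := (k - h - 1)%N.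
Definition gstar_q : nat := (n - k - 2 * h - 1)%N.

(* The indices kept: index 3 (the class W) is dropped when w = 0. *)
Definition gstar_dim : nat := if gstar_w is 0%N then 6%N else 7%N.

Definition gstar_index : 'I_gstar_dim -> 'I_7 :=
  match gstar_w as w return 'I_(if w is 0%N then 6%N else 7%N) -> 'I_7 with
  | 0%N => lift (inord 3)
  | _.+1 => id
  end.

Definition gstar_class (i : 'I_gstar_dim) : {set gstar} :=
  nth set0 [:: gstar_C; gstar_L; gstar_I; gstar_W; gstar_Y1; gstar_Y2; gstar_Y3]
    (gstar_index i).

Definition gstar_class_size (i : 'I_gstar_dim) : nat :=
  nth 0%N [:: 1; h; h + 1; gstar_w; 1; h - 1; gstar_q]%N (gstar_index i).

Definition gstar_mx7 : 'M[int]_7 :=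
  let H := h%:Z in let w := gstar_w%:Z in let q := gstar_q%:Z in
  \matrix_(i, j) nth 0 (nth [::]
    [:: [:: 0; 0;     H + 1; w;     1; H - 1; 0    ];
        [:: 0; H - 1; H + 1; w;     1; 0;     0    ];
        [:: 1; H;     H;     w;     0; 0;     0    ];
        [:: 1; H;     H + 1; w - 1; 1; H - 1; q    ];
        [:: 1; H;     0;     w;     0; H - 1; q    ];
        [:: 1; 0;     0;     w;     1; H - 2; q    ];
        [:: 0; 0;     0;     w;     1; H - 1; q - 1]] i) j.

Definition gstar_mx : 'M[int]_gstar_dim := mxsub gstar_index gstar_index gstar_mx7.

End GStar.

Arguments gstar_index : clear implicits.
Arguments gstar_class : clear implicits.
Arguments gstar_class_size : clear implicits.

(* Main.v *)
Require Import Defs.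
From mathcomp Require Import all_boot all_order all_algebra zify.
Local Open Scope ring_scope.
Set Implicit Arguments.
Unset Strict Implicit.
Unset Printing Implicit Defensive.
Import Order.TTheory GRing.Theory Num.Theory.
Local Open Scope sesquilinear_scope.

(** The spectral radius statement holds for every equitable partition of every
nonempty graph. Let A be the adjacency matrix, S the 0/1 incidence matrix of
vertices against classes, and Q the quotient matrix; equitability says exactly
that A S = S Q. An eigenvector of Q is therefore lifted by S to an eigenvector
of A, which is nonzero because no class is empty ([eigenvalue_quotient]), so
rho(Q) <= rho(A). Conversely, a left eigenvector of A for rho(A) is sent by S
to the vector of its sums over the classes; these sums could all vanish, unless
the eigenvector is nonnegative ([quotient_perron_eigenvalue]).

A nonnegative eigenvector has to be found over an arbitrary algebraically
closed field with a norm, where compactness arguments are not available. It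
comes from the symmetry of A ([normal_perron_vector]). Take x with x A = a x
and |a| = r = rho(A), and let y = |x| entrywise. The triangle inequality
gives r y <= y A entrywise, while the spectral theorem for normal matrices
gives ||y A|| <= r ||y||. All entries are nonnegative, so the two bounds force
y A = r y.

For the graph at hand, the seven classes behave as the vertices of a small
graph that has been blown up into cliques: between two classes either all edges
or no edges are present, and each class is a clique ([gstar_edgeE]). Hence a
vertex of class i has either no neighbour in class j, or all of class j, minus
itself when i = j. The quotient matrix is read off from this rule and from the
class sizes. The bound n >= 2 (k + h) + 2 already ensures that Y has more than h
vertices, so that y_1, ..., y_h exist and the last class is nonempty. *)

(** * Norm bounds for normal matrices *)

Lemma eigenvalueE (F : fieldType) n (A : 'M[F]_n) a :
  eigenvalue A a = (A - a%:M \notin unitmx).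
Proof. by rewrite /eigenvalue /eigenspace kermx_eq0 row_free_unit. Qed.

(** Eigenvectors are row vectors here, whereas an equitable partition acts on the
other side; transposing moves between the two. *)
Lemma eigenvalue_trmx (F : fieldType) n (A : 'M[F]_n) a :
  eigenvalue A^T a = eigenvalue A a.
Proof.
by rewrite !eigenvalueE -(tr_scalar_mx n a) -raddfB /= unitmx_tr tr_scalar_mx.
Qed.

(** The rows of the diagonalizing unitary matrix are eigenvectors. *)
Lemma spectral_diag_eigenvalue (C : numClosedFieldType) n (A : 'M[C]_n) i :
  A \is normalmx -> eigenvalue A (spectral_diag A 0 i).
Proof.
move=> /orthomx_spectralP defA; apply/eigenvalueP.
have Pu := spectral_unit A.
exists (row i (spectralmx A)).
  rewrite -row_mul [in X in _ *m X]defA !mulmxA mulmxV // mul1mx.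
  by apply/rowP=> j; rewrite mul_diag_mx !mxE.
apply/eqP=> /(congr1 (mulmx^~ (invmx (spectralmx A)))).
rewrite -row_mul mulmxV // mul0mx => /rowP/(_ i).
by rewrite !mxE eqxx => /eqP; rewrite oner_eq0.
Qed.

Definition sqnorm (C : numClosedFieldType) n (v : 'rV[C]_n) : C :=
  \sum_i `|v 0 i| ^+ 2.

Lemma sqnorm_unitary (C : numClosedFieldType) n (v : 'rV[C]_n) (U : 'M_n) :
  U \is unitarymx -> sqnorm (v *m U) = sqnorm v.
Proof.
have sqE (u : 'rV[C]_n) : sqnorm u = (u *m u^t*) 0 0.
  by rewrite mxE; apply: eq_bigr => i _; rewrite !mxE normCK.
by move=> Uu; rewrite !sqE trmx_mul map_mxM mulmxA mulmxtVK.
Qed.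

(** In an orthonormal eigenbasis A multiplies each coordinate by an eigenvalue,
and multiplying by a unitary matrix does not change the norm. *)
Lemma sqnorm_mulmx_le (C : numClosedFieldType) n (A : 'M[C]_n) (v : 'rV_n) :
  (0 < n)%N -> A \is normalmx ->
  sqnorm (v *m A) <= spectral_radius A ^+ 2 * sqnorm v.
Proof.
move=> n_gt0 An; have [[b _ def_r] le_r] := spectral_radiusP A n_gt0.
have Pu := spectral_unitarymx A; set P := spectralmx A in Pu.
(* Let u be v times the adjoint of P: as P is unitary, v A has the norm of
   u D, with D the diagonal matrix of eigenvalues, and v has that of u. *)
have Pt : P^t* \is unitarymx by rewrite trmxC_unitary.
have /orthomx_spectralP defA := An.
rewrite {1}defA -/P invmx_unitary // !mulmxA sqnorm_unitary //.
rewrite -(sqnorm_unitary v Pt) mulr_sumr.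
set u := v *m _; apply: ler_sum => i _.
have -> : (u *m diag_mx (spectral_diag A)) 0 i = u 0 i * spectral_diag A 0 i.
  by rewrite mul_mx_diag mxE.
rewrite normrM exprMn mulrC.
apply: ler_wpM2r; first by rewrite exprn_ge0.
rewrite lerXn2r ?nnegrE //; first by rewrite def_r.
exact/le_r/spectral_diag_eigenvalue.
Qed.

(** * A Perron vector for nonnegative normal matrices *)

(** Taking absolute values in an eigenvector x of maximal modulus gives y with
r y <= y A entrywise. Each term (y A)_i^2 - (r y_i)^2 is then nonnegative, and
their sum is at most 0 by [sqnorm_mulmx_le], so every term vanishes. *)
Lemma normal_perron_vector (C : numClosedFieldType) n (A : 'M[C]_n) :
    (0 < n)%N -> A \is normalmx -> (forall i j, 0 <= A i j) ->
  exists2 y : 'rV[C]_n, (forall i, 0 <= y 0 i) &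
    y != 0 /\ y *m A = spectral_radius A *: y.
Proof.
move=> n_gt0 An A_ge0; have [[a]] := spectral_radiusP A n_gt0.
move=> /eigenvalueP[x xA x_nz] def_r _.
pose y := \row_i `|x 0 i|; pose z := y *m A.
set r := spectral_radius A in def_r *.
have y_ge0 i : 0 <= y 0 i by rewrite mxE.
have r_ge0 : 0 <= r by rewrite def_r.
have ry_le i : r * y 0 i <= z 0 i.
  have /rowP/(_ i) := xA; rewrite !mxE def_r -normrM => <-.
  apply: le_trans (ler_norm_sum _ _ _) _; apply: ler_sum => j _.
  by rewrite normrM mxE (ger0_norm (A_ge0 _ _)).
have ry_ge0 i : 0 <= r * y 0 i by rewrite mulr_ge0.
have z_ge0 i : 0 <= z 0 i by apply: le_trans (ry_le i).
have gap_ge0 i : 0 <= z 0 i ^+ 2 - (r * y 0 i) ^+ 2.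
  by rewrite subr_ge0 lerXn2r ?nnegrE.
have gap0 : \sum_i (z 0 i ^+ 2 - (r * y 0 i) ^+ 2) == 0.
  rewrite eq_le sumr_ge0 ?andbT // sumrB subr_le0.
  have := @sqnorm_mulmx_le _ _ _ y n_gt0 An; rewrite -/z -/r /sqnorm mulr_sumr.
  congr (_ <= _); apply: eq_bigr => i _; first by rewrite ger0_norm.
  by rewrite ger0_norm // exprMn.
exists y => //; split.
  apply: contraNneq x_nz => /rowP y0; apply/eqP/rowP=> i.
  by have := y0 i; rewrite !mxE => /normr0_eq0.
apply/rowP=> i; rewrite -/z [RHS]mxE.
move: gap0; rewrite psumr_eq0 // => /allP/(_ i (mem_index_enum _)).
by rewrite /= subr_eq0 eqrXn2 // => /eqP.
Qed.

Lemma adjacency_normal (C : numClosedFieldType) (G : sgraph) :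
  adjacency_mx C G \is normalmx.
Proof.
have trA : (adjacency_mx C G)^t* = adjacency_mx C G.
  by apply/matrixP=> i j; rewrite !mxE conjC_nat sedge_sym.
by apply/normalmxP; rewrite trA.
Qed.

(** * Spectral radius of an equitable partition *)

Section Quotient.
Variables (C : numClosedFieldType) (G : sgraph) (m : nat).
Variables (P : 'I_m -> {set G}) (Q : 'M[int]_m).
Hypotheses (equitP : equitable P) (quoP : is_quotient_mx P Q).

Definition class_mx : 'M[C]_(#|G|, m) := \matrix_(i, j) (enum_val i \in P j)%:R.

Lemma class_of_vertex (v : G) : exists i, forall j, (v \in P j) = (j == i).
Proof.
have [injP /and3P[/eqP covP trivP _] _] := equitP.
have : v \in cover [set P i | i : 'I_m] by rewrite covP.
case/bigcupP=> _ /imsetP[i _ ->] vi; exists i => j.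
apply/idP/eqP=> [vj|-> //]; apply: injP; apply/eqP; apply/negPn/negP=> ne.
have PP l : P l \in [set P i | i : 'I_m] by apply: imset_f.
have /disjoint_setI0/setP/(_ v) := trivIsetP trivP _ _ (PP j) (PP i) ne.
by rewrite !inE vj vi.
Qed.

Lemma class_inhabited i : exists v : G, forall j, (v \in P j) = (j == i).
Proof.
have [_ /and3P[_ _ nz] _] := equitP.
have [Pi0|[v vi]] := set_0Vmem (P i).
  by case/negP: nz; rewrite -Pi0 imset_f.
have [j vj] := class_of_vertex v; exists v.
by move: vi; rewrite vj => /eqP->.
Qed.

(** Row u, column j of either side is the number of neighbours of u in class j. *)
Lemma adjacency_class_mx :
  adjacency_mx C G *m class_mx = class_mx *m map_mx intr Q.
Proof.
apply/matrixP=> u j; rewrite !mxE.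
have [i ui] := class_of_vertex (enum_val u).
rewrite [RHS](bigD1 i) //= [X in _ = _ + X]big1 ?addr0 => [|l /negPf li]; last first.
  by rewrite !mxE ui li mul0r.
rewrite !mxE ui eqxx mul1r -(quoP j (v := enum_val u)) ?ui //.
have -> : #|neighbors (enum_val u) :&: P j|%:~R =
    \sum_(v in G) (sedge (enum_val u) v && (v \in P j))%:R :> C.
  rewrite -pmulrn -sum1_card natr_sum big_mkcond /=; apply: eq_big => [v|v _] //.
  by rewrite !inE; case: (_ && _).
by rewrite [RHS]big_enum_val; apply: eq_bigr => v _; rewrite !mxE -natrM mulnb.
Qed.

(** The lifted eigenvector is constant on each class, with the entries of the
original one as values; as every class is inhabited, it is nonzero. *)
Lemma eigenvalue_quotient a :
  eigenvalue (map_mx intr Q) a -> eigenvalue (adjacency_mx C G) a.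
Proof.
rewrite -eigenvalue_trmx => /eigenvalueP[x xQ x_nz].
rewrite -eigenvalue_trmx; apply/eigenvalueP; exists (x *m class_mx^T).
  by rewrite -mulmxA -trmx_mul adjacency_class_mx trmx_mul mulmxA xQ -scalemxAl.
apply: contraNneq x_nz => /rowP xP0; apply/eqP/rowP=> i.
have [v vi] := class_inhabited i; have := xP0 (enum_rank v).
rewrite !mxE (bigD1 i) //= big1 ?addr0 => [|l /negPf li].
  by rewrite !mxE enum_rankK vi eqxx mulr1.
by rewrite !mxE enum_rankK vi li mulr0.
Qed.

(** Summing a Perron vector of the graph over the classes yields an eigenvector of
the quotient: nonnegative terms cannot cancel in these sums. *)
Lemma quotient_perron_eigenvalue : (0 < #|G|)%N ->
  eigenvalue (map_mx intr Q) (graph_spectral_radius C G).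
Proof.
move=> G_gt0.
have A_ge0 i j : 0 <= adjacency_mx C G i j by rewrite mxE ler0n.
have [y y_ge0 [y_nz yA]] :=
  normal_perron_vector G_gt0 (adjacency_normal C G) A_ge0.
apply/eigenvalueP; exists (y *m class_mx).
  by rewrite -mulmxA -adjacency_class_mx mulmxA yA -scalemxAl.
apply: contraNneq y_nz => /rowP yP0; apply/eqP/rowP=> u.
have [i ui] := class_of_vertex (enum_val u); have := yP0 i; rewrite !mxE.
move/eqP; rewrite psumr_eq0 => [|v _]; last by rewrite mulr_ge0 // mxE ler0n.
move/allP/(_ u (mem_index_enum _)); rewrite /= mxE ui eqxx mulr1.
by move/eqP.
Qed.

Theorem spectral_radius_quotient : (0 < #|G|)%N ->
  graph_spectral_radius C G = spectral_radius (map_mx intr Q : 'M[C]_m).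
Proof.
move=> G_gt0; have [v0 _] := card_gt0P G_gt0.
have [i0 _] := class_of_vertex v0.
have m_gt0 : (0 < m)%N by case: m i0 => [[]|].
have [[a Aa rA] le_rA] := spectral_radiusP (adjacency_mx C G) G_gt0.
have [[b Qb rQ] le_rQ] := spectral_radiusP (map_mx intr Q : 'M[C]_m) m_gt0.
apply/eqP; rewrite eq_le; apply/andP; split.
  have := le_rQ _ (quotient_perron_eigenvalue G_gt0).
  by rewrite ger0_norm // /graph_spectral_radius rA.
by rewrite rQ; apply: le_rA; apply: eigenvalue_quotient.
Qed.
End Quotient.

(** * The classes of the graph and their sizes *)

Lemma card_ord_interval N a b : (b <= N)%N ->
  #|[set j : 'I_N | (a <= j < b)%N]| = (b - a)%N.
Proof.
move=> bN; rewrite -sum1_card (eq_bigl (fun j : 'I_N => a <= j < b)%N); last first.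
  by move=> j; rewrite inE.
rewrite -(big_mkord (fun j => a <= j < b)%N (fun=> 1%N)).
rewrite -(big_nat_widen _ _ _ (fun j => a <= j)%N _ bN).
by rewrite -(big_nat_widenl a 0 b predT) // sum_nat_const_nat muln1.
Qed.

Section GStar.
Variables h k n : nat.
Local Notation G := (gstar h k n).

(** The classes and sizes are first treated on all seven indices, an empty W
included; the index map that skips W comes in only at the end. *)
Definition gstar_class7 (i : nat) : {set G} :=
  nth set0 [:: gstar_C h k n; gstar_L h k n; gstar_I h k n; gstar_W h k n;
    gstar_Y1 h k n; gstar_Y2 h k n; gstar_Y3 h k n] i.

Definition gstar_size7 (i : nat) : nat :=
  nth 0%N [:: 1; h; h + 1; gstar_w h k; 1; h - 1; gstar_q h k n]%N i.

Definition gstar_label (v : G) : nat :=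
  match v with
  | Xc => 0 | XL _ => 1 | XI _ => 2 | VW _ => 3
  | VY j => if j == 0 :> nat then 4 else if j < h then 5 else 6
  end%N.

Lemma gstar_label_lt7 v : (gstar_label v < 7)%N.
Proof. by case: v => //= j; do 2?case: ifP. Qed.

(** The case of y_1 needs h > 0: the label of VY 0 is 4, and Y3 starts at h. *)
Lemma mem_gstar_class7 i v : (2 <= h)%N -> (i < 7)%N ->
  (v \in gstar_class7 i) = (gstar_label v == i).
Proof.
move=> h_ge2.
have notin_im (T : finType) (F : T -> G) (A : {pred T}) (u : G) :
    (forall x, F x <> u) -> (u \in F @: A) = false.
  by move=> Fu; apply/imsetP=> -[x _ /esym/Fu].
have Li : injective (XL : _ -> G) by move=> x y [].
have Ii : injective (XI : _ -> G) by move=> x y [].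
have Wi : injective (VW : _ -> G) by move=> x y [].
have Yi : injective (VY : _ -> G) by move=> x y [].
case: i => [|[|[|[|[|[|[|//]]]]]]] _; case: v => [|x|x|x|x];
  rewrite /gstar_class7 /= /gstar_C /gstar_L /gstar_I /gstar_W
    /gstar_Y1 /gstar_Y2 /gstar_Y3 ?inE ?(mem_imset _ _ Li) ?(mem_imset _ _ Ii)
    ?(mem_imset _ _ Wi) ?(mem_imset _ _ Yi) ?notin_im ?inE //=.
1: by have /negPf-> : VY x != Xc :> G by []; do 2?case: ifP.
all: by case: ifP => [/eqP|] x0; last case: ifP => xh; lia.
Qed.

Lemma card_gstar_class7 i : (2 <= h)%N -> (2 * (k + h) + 2 <= n)%N ->
  (i < 7)%N -> #|gstar_class7 i| = gstar_size7 i.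
Proof.
move=> h_ge2 n_ge.
have cardY a b (A : {pred 'I_(n - k - h - 1)}) :
    (b <= n - k - h - 1)%N -> (forall j, (j \in A) = (a <= j < b)%N) ->
  #|[set (VY j : G) | j in A]| = (b - a)%N.
  move=> b_le A_def; rewrite card_imset => [|x y []] //.
  by rewrite -(card_ord_interval a b_le); apply: eq_card => j; rewrite A_def inE.
case: i => [|[|[|[|[|[|[|//]]]]]]] _; rewrite /gstar_class7 /=.
- by rewrite cards1.
- by rewrite card_imset ?card_ord // => x y [].
- by rewrite card_imset ?card_ord /gstar_size7 /= ?addn1 // => x y [].
- by rewrite card_imset ?card_ord // => x y [].
- rewrite /gstar_Y1 (cardY 0 1)%N //; first by lia.
  by move=> j; rewrite inE /= ltnS leqn0.
- by rewrite /gstar_Y2 (cardY 1 h)%N // => [|j]; [lia | rewrite inE].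
- rewrite /gstar_Y3 (cardY h (n - k - h - 1))%N //.
    by rewrite /gstar_size7 /= /gstar_q; lia.
  by move=> j; rewrite inE ltn_ord andbT.
Qed.

(** * Adjacency as a blow-up of a seven-vertex pattern *)

(** The diagonal is true because each class induces a clique; for the one-vertex
classes of c and y_1 this holds vacuously. *)
Definition gstar_joined (i j : nat) : bool :=
  nth false (nth [::]
    [:: [:: true;  false; true;  true; true;  true;  false];
        [:: false; true;  true;  true; true;  false; false];
        [:: true;  true;  true;  true; false; false; false];
        [:: true;  true;  true;  true; true;  true;  true];
        [:: true;  true;  false; true; true;  true;  true];
        [:: true;  false; false; true; true;  true;  true];
        [:: false; false; false; true; true;  true;  true]] i) j.

Lemma gstar_edgeE (u v : G) : (2 <= h)%N ->
  sedge u v = (u != v) && gstar_joined (gstar_label u) (gstar_label v).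
Proof.
move=> h_ge2.
have Y_cases (j : 'I_(n - k - h - 1)) :
    [\/ (j == 0%N :> nat, (j < h)%N) = (true, true),
        (j == 0%N :> nat, (j < h)%N) = (false, true)
      | (j == 0%N :> nat, (j < h)%N) = (false, false)].
  case: (posnP j) => [->|_]; first by rewrite (ltnW h_ge2); constructor 1.
  by case: (ltnP j h); [constructor 2 | constructor 3].
case: u => [|x|x|x|x]; case: v => [|y|y|y|y] //=; rewrite ?andbT //;
  try (case: (Y_cases x) => -[x0 xh]; rewrite ?x0 ?xh);
  try (case: (Y_cases y) => -[y0 yh]; rewrite ?y0 ?yh);
  by rewrite /= ?andbT.
Qed.

Lemma card_neighbors_class7 (v : G) j : (2 <= h)%N -> (j < 7)%N ->
  #|neighbors v :&: gstar_class7 j| =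
    (gstar_joined (gstar_label v) j *
      (#|gstar_class7 j| - (gstar_label v == j)))%N.
Proof.
move=> h_ge2 j_lt7.
have -> : neighbors v :&: gstar_class7 j =
    if gstar_joined (gstar_label v) j then gstar_class7 j :\ v else set0.
  apply/setP=> u; rewrite !inE gstar_edgeE // eq_sym.
  case: ifP => joined_j; rewrite ?inE mem_gstar_class7 //;
    by case: (gstar_label u =P j) => [->|_]; rewrite ?joined_j ?andbT ?andbF.
case: ifP => _; last by rewrite cards0.
by rewrite mul1n [in RHS](cardsD1 v) mem_gstar_class7 // addKn.
Qed.

(** * Discarding the empty class W *)

Lemma gstar_index_inj : injective (gstar_index h k).
Proof.
rewrite /gstar_index /gstar_dim; case: (gstar_w h k) => [|w] //.
exact: lift_inj.
Qed.

Lemma gstar_index_surj i : (i < 7)%N -> (gstar_w h k = 0%N -> i <> 3) ->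
  exists j, gstar_index h k j = i :> nat.
Proof.
move=> i_lt7; rewrite /gstar_index /gstar_dim; case: (gstar_w h k) => [|w] i_neq3.
  have [j defj|eq3] := unliftP (inord 3) (Ordinal i_lt7).
    by exists j; rewrite -[LHS]/(val (lift (inord 3) j)) -defj.
  by case: (i_neq3 erefl); rewrite -[i]/(val (Ordinal i_lt7)) eq3 /= inordK.
by exists (Ordinal i_lt7).
Qed.

Lemma gstar_size7_gt0 (v : G) : (2 <= h)%N -> (2 * (k + h) + 2 <= n)%N ->
  (0 < gstar_size7 (gstar_label v))%N.
Proof.
move=> h_ge2 n_ge; have v_lt7 := gstar_label_lt7 v.
rewrite -card_gstar_class7 //; apply/card_gt0P; exists v.
by rewrite mem_gstar_class7.
Qed.

(** The entries w - 1, h - 2 and q - 1 of the matrix are integer differences,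
whereas [card_neighbors_class7] subtracts in nat. They agree because the class
of a vertex is nonempty. *)
Lemma gstar_is_quotient : (2 <= h)%N -> (2 * (k + h) + 2 <= n)%N ->
  is_quotient_mx (gstar_class h k n) (gstar_mx h k n).
Proof.
move=> h_ge2 n_ge i j v; rewrite mxE.
rewrite -[gstar_class h k n i]/(gstar_class7 (gstar_index h k i)).
rewrite -[gstar_class h k n j]/(gstar_class7 (gstar_index h k j)).
move: (gstar_index h k i) (gstar_index h k j) => {}i {}j.
rewrite mem_gstar_class7 // card_neighbors_class7 // card_gstar_class7 //.
move=> /eqP vi; have := gstar_size7_gt0 v h_ge2 n_ge; rewrite vi mxE.
case: i {vi} => [[|[|[|[|[|[|[|//]]]]]]] ?];
  case: j => [[|[|[|[|[|[|[|//]]]]]]] ?]; rewrite /gstar_size7 /gstar_joined /=; lia.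
Qed.

Lemma card_gstar_class i : (2 <= h)%N -> (2 * (k + h) + 2 <= n)%N ->
  #|gstar_class h k n i| = gstar_class_size h k n i.
Proof. by move=> h_ge2 n_ge; apply: card_gstar_class7. Qed.

(** A vertex labelled 3 lies in W, so W is kept whenever it is needed to cover. *)
Lemma gstar_index_label v : (2 <= h)%N -> (2 * (k + h) + 2 <= n)%N ->
  exists i, gstar_index h k i = gstar_label v :> nat.
Proof.
move=> h_ge2 n_ge; apply: gstar_index_surj (gstar_label_lt7 v) _ => w0 v3.
by have := gstar_size7_gt0 v h_ge2 n_ge; rewrite v3 /gstar_size7 /= w0.
Qed.

Lemma gstar_index_neq3 i : gstar_w h k = 0%N -> gstar_index h k i <> 3 :> nat.
Proof.
move: i; rewrite /gstar_index /gstar_dim; case: (gstar_w h k) => // i _.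
by move=> i3; case/eqP: (neq_lift (inord 3) i); apply: ord_inj; rewrite i3 inordK.
Qed.

Lemma gstar_class_inhabited i : (2 <= h)%N -> (2 * (k + h) + 2 <= n)%N ->
  exists v, v \in gstar_class h k n i.
Proof.
move=> h_ge2 n_ge; apply/card_gt0P; rewrite card_gstar_class //.
rewrite /gstar_class_size; have := @gstar_index_neq3 i.
case: (gstar_index h k i) => [[|[|[|[|[|[|[|//]]]]]]] ?]; rewrite /= /gstar_q; lia.
Qed.

Lemma gstar_equitable : (2 <= h)%N -> (2 * (k + h) + 2 <= n)%N ->
  equitable (gstar_class h k n).
Proof.
move=> h_ge2 n_ge.
have mem_class i v :
    (v \in gstar_class h k n i) = (gstar_label v == gstar_index h k i).
  exact: mem_gstar_class7.
have class_eq i j v : v \in gstar_class h k n i -> v \in gstar_class h k n j ->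
    i = j.
  rewrite !mem_class => /eqP-> /eqP/val_inj; exact: gstar_index_inj.
split; last by exists (gstar_mx h k n); apply: gstar_is_quotient.
  move=> i j eq_ij; have [v vi] := gstar_class_inhabited i h_ge2 n_ge.
  by apply: (class_eq i j v); rewrite // -eq_ij.
apply/and3P; split.
- apply/eqP/setP=> v; rewrite inE; apply/bigcupP.
  have [i vi] := gstar_index_label v h_ge2 n_ge.
  by exists (gstar_class h k n i); rewrite ?imset_f // mem_class vi.
- apply/trivIsetP=> _ _ /imsetP[i _ ->] /imsetP[j _ ->]; apply: contraR.
  by case/pred0Pn=> v /andP[/= vi vj]; rewrite (class_eq i j v).
apply/imsetP=> -[i _ class0].
have [v] := gstar_class_inhabited i h_ge2 n_ge.
by rewrite -class0 inE.
Qed.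
End GStar.

(** * The spectral radius of the graph *)

Theorem proposition2p15 (h k : nat) (hh : (2 <= h)%N) (hk : (h + 1 <= k)%N) :
  exists n_int : nat, (2 * (k + h) + 2 <= n_int)%N /\
    forall n : nat, (n_int <= n)%N ->
      [/\ equitable (gstar_class h k n),
          forall i, #|gstar_class h k n i| = gstar_class_size h k n i,
          is_quotient_mx (gstar_class h k n) (gstar_mx h k n)
        & forall C : numClosedFieldType,
            graph_spectral_radius C (gstar h k n) =
            spectral_radius (map_mx intr (gstar_mx h k n) : 'M[C]_(gstar_dim h k))].
Proof.
exists (2 * (k + h) + 2)%N; split=> // n n_ge; split.
- exact: gstar_equitable.
- by move=> i; apply: card_gstar_class.
- exact: gstar_is_quotient.
move=> C; apply: spectral_radius_quotient.
- exact: gstar_equitable.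
- exact: gstar_is_quotient.
by apply/card_gt0P; exists Xc.
Qed.
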